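(* The set $\{\overleftrightarrow{K_2}, \overrightarrow{K_2}\}$ is the unique heroic set of size two, i.e. it is the only set $\mathcal F$ of exactly two digraphs such that $Forb_{ind}(\mathcal F)$ has bounded dichromatic number.
   Context: Digraphs have no loops and no parallel arcs, but both $xy$ and $yx$ may be arcs. An acyclic coloring (dicoloring) of a digraph $D$ is a coloring of its vertices such that no color class induces a directed cycle; the dichromatic number $\vec\chi(D)$ is the minimum number of colors in such a coloring. For a class $\mathcal C$, $\vec\chi(\mathcal C)=\sup\{\vec\chi(D): D\in\mathcal C\}$. For a set $\mathcal F$ of digraphs, $Forb_{ind}(\mathcal F)$ is the class of digraphs containing no member of $\mathcal F$ as an induced subdigraph. A set $\mathcal F$ is heroic if $Forb_{ind}(\mathcal F)$ has bounded dichromatic number. $\overleftrightarrow{K_2}$ is the digraph on two vertices $x,y$ with both arcs $xy$ and $yx$ (a digon); $\overrightarrow{K_2}$ is the digraph on two vertices with exactly one arc.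
   Formalization: The uniqueness is stated for sets whose members all have at least two vertices, since any set containing a digraph on at most one vertex, such as {K_1, H}, is trivially heroic. *)

(* Defs.v *)
From HB Require Import structures.
From mathcomp Require Import all_boot.
From mathcomp Require Import boolp.

Set Implicit Arguments.
Unset Strict Implicit.
Unset Printing Implicit Defensive.

(* Finite digraphs: no loops; [arc] being a relation, no parallel arcs, but
   opposite arcs are allowed. *)
Record digraph := Digraph {
  vertex :> finType;
  arc : rel vertex;
  arc_irrefl : irreflexive arc
}.

Definition isomorphic (D E : digraph) : Prop :=
  exists2 f : D -> E, bijective f & forall x y, arc (f x) (f y) = arc x y.

(* An induced subdigraph of D isomorphic to H is the image of such an f. *)
Definition contains_induced (D H : digraph) : Prop :=
  exists2 f : H -> D, injective f & forall x y, arc (f x) (f y) = arc x y.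

(* A digon is a directed cycle of length 2; length 1 is excluded by
   irreflexivity of [arc]. *)
Definition dicycle (D : digraph) (p : seq D) : bool :=
  [&& p != [::], uniq p & cycle (@arc D) p].

Definition dicoloring (D : digraph) (k : nat) (f : D -> 'I_k) : Prop :=
  forall (c : 'I_k) (p : seq D), dicycle p -> ~ {in p, forall x, f x = c}.

Definition dicolorable (D : digraph) (k : nat) : Prop :=
  exists f : D -> 'I_k, dicoloring f.

Lemma dicolorable_card (D : digraph) : dicolorable D #|D|.
Proof.
exists (@enum_rank D) => c [|x [|y p]] //=.
  by rewrite /dicycle /= arc_irrefl.
move=> /and3P[_ /= /andP[xNyp _] _] fc.
have xy : x = y.
  by apply: enum_rank_inj; rewrite !fc // !inE eqxx ?orbT.
by rewrite xy inE eqxx in xNyp.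
Qed.

Lemma ex_dicolorable (D : digraph) : exists k, `[< dicolorable D k >].
Proof. by exists #|D|; apply/asboolP/dicolorable_card. Qed.

Definition dichromatic (D : digraph) : nat := ex_minn (ex_dicolorable D).

Definition Forb_ind (F : digraph -> Prop) (D : digraph) : Prop :=
  forall H, F H -> ~ contains_induced D H.

Definition bounded_dichromatic (C : digraph -> Prop) : Prop :=
  exists k, forall D, C D -> dichromatic D <= k.

Definition heroic (F : digraph -> Prop) : Prop :=
  bounded_dichromatic (Forb_ind F).

(* Sets of digraphs are considered up to isomorphism of their members. *)
Definition same_digraphs (F G : digraph -> Prop) : Prop :=
  (forall D, F D -> exists2 E, G E & isomorphic D E) /\
  (forall E, G E -> exists2 D, F D & isomorphic D E).

Definition pair_set (A B : digraph) : digraph -> Prop :=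
  fun D => D = A \/ D = B.

Definition size_two (F : digraph -> Prop) : Prop :=
  exists A B, ~ isomorphic A B /\ same_digraphs F (pair_set A B).

(* Any set with a member on at most one vertex is vacuously heroic, since then
   Forb_ind contains at most the digraph without vertices. *)
Definition nontrivial (F : digraph -> Prop) : Prop :=
  forall D, F D -> 1 < #|D|.

Definition digon_arc : rel bool := fun x y => x != y.

Lemma digon_arc_irrefl : irreflexive digon_arc.
Proof. by case. Qed.

Definition digon : digraph := Digraph digon_arc_irrefl.

Definition arrow_arc : rel bool := fun x y => ~~ x && y.

Lemma arrow_arc_irrefl : irreflexive arrow_arc.
Proof. by case. Qed.

Definition arrow : digraph := Digraph arrow_arc_irrefl.

(* Main.v *)
Require Import Defs.
From mathcomp Require Import all_boot.
From mathcomp Require Import boolp zify.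
(* path.arc shadows the arc relation of digraphs. *)
Import Defs.

(** Call increasing quadruples X = (x1,x2,x3,x4) and Y of numbers below N
    1-linked if (y1,y2,y3) = (x2,x3,x4) and 3-linked if y1 = x4; put an arc
    X -> Y in the first case and Y -> X in the second.  Comparing the first
    entries of three quadruples shows that the underlying graph has no triangle.
    A path of three 1-links is closed by a 3-link into a directed cycle, so a
    dicoloring makes no such path monochromatic; recording how long a
    monochromatic path ends at X refines the dicoloring to a proper coloring
    of the shift graph on quadruples.  Descending from quadruples to
    triples, pairs and points (a tuple gets the set of colors of its
    extensions) yields an injection of 'I_N into a finite set independent of
    N.  Hence the dichromatic number is unbounded.

    Adding arcs cannot decrease the dichromatic number, so the completion, a
    tournament completion, the symmetrization and the digraph itself are all
    of large dichromatic number.  The first two force F to consist of a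
    complete symmetric digraph and a tournament; the last two, being
    triangle-free, force both to have two vertices. *)

Set Implicit Arguments.
Unset Strict Implicit.
Unset Printing Implicit Defensive.

(** * Isomorphism, induced containment and monotonicity of dicolorability *)

Lemma isomorphic_sym (D E : digraph) : isomorphic D E -> isomorphic E D.
Proof.
case=> f [g fK gK] fa; exists g; first by exists f.
by move=> x y; rewrite -fa !gK.
Qed.

Lemma isomorphic_trans (D E H : digraph) :
  isomorphic D E -> isomorphic E H -> isomorphic D H.
Proof.
move=> [f fb fa] [g gb ga]; exists (g \o f); first exact: bij_comp.
by move=> x y /=; rewrite ga fa.
Qed.

Lemma isomorphic_card (D E : digraph) : isomorphic D E -> #|D| = #|E|.
Proof. by case=> f fb _; exact: bij_eq_card fb. Qed.

Lemma contains_induced_iso (D H K : digraph) :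
  isomorphic H K -> contains_induced D H -> contains_induced D K.
Proof.
case/isomorphic_sym=> g gb ga [f fi fa]; exists (f \o g).
  exact: inj_comp fi (bij_inj gb).
by move=> x y /=; rewrite fa ga.
Qed.

Lemma dicolorable_dichromatic (D : digraph) : dicolorable D (dichromatic D).
Proof. by rewrite /dichromatic; case: ex_minnP => m /asboolP. Qed.

Lemma dichromatic_min (D : digraph) k : dicolorable D k -> dichromatic D <= k.
Proof.
by move=> Dk; rewrite /dichromatic; case: ex_minnP => m _; apply; apply/asboolP.
Qed.

Lemma dicolorable_leq (D : digraph) k m :
  k <= m -> dicolorable D k -> dicolorable D m.
Proof.
move=> km [f fc]; exists (fun x => widen_ord km (f x)) => c p pc fp.
(* The color [c] is only known to lie below [m]; a vertex of the cycle supplies the same color below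
   [k]. *)
case: p pc fp => [//|x p] pc fp.
apply: (fc (f x) _ pc) => y yp; apply: val_inj.
have := congr1 val (fp y yp); have := congr1 val (fp x (mem_head x p)).
by move=> /= -> ->.
Qed.

Lemma dicolorable_super (D : digraph) (e : rel D) (ei : irreflexive e) k :
  subrel (@arc D) e -> dicolorable (Digraph ei) k -> dicolorable D k.
Proof.
move=> De [f fc]; exists f => c p /and3P[p0 pu pc]; apply: fc.
by rewrite /dicycle p0 pu; exact: sub_cycle De _ pc.
Qed.

(** * A triangle-free family of unbounded dichromatic number *)

Section ShiftDigraph.

Variable N : nat.

Definition quad := ('I_N * 'I_N * 'I_N * 'I_N)%type.

Definition increasing (X : quad) : bool :=
  let: (a, b, c, d) := X in [&& a < b, b < c & c < d].

Definition link1 : rel quad := fun X Y =>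
  let: (a, b, c, d) := X in let: (a', b', c', d') := Y in
  [&& increasing X, increasing Y, a' == b, b' == c & c' == d].

Definition link3 : rel quad := fun X Y =>
  let: (a, b, c, d) := X in let: (a', b', c', d') := Y in
  [&& increasing X, increasing Y & a' == d].

Definition shift_arc : rel quad := fun X Y => link1 X Y || link3 Y X.

(** The underlying graph, with both kinds of link oriented towards the larger first entry. *)
Definition link : rel quad := fun X Y => link1 X Y || link3 X Y.

Lemma link_lt X Y : link X Y -> X.1.1.1 < Y.1.1.1.
Proof.
case: X Y => [[[a b] c] d] [[[a' b'] c'] d'].
case/orP=> /=; rewrite -?val_eqE /=; lia.
Qed.

(** With X = (a,b,c,d), two successive links lead to a first entry that is c or exceeds d, while one
    link from X leads to b or d. *)
Lemma link_intransitive X Y Z : link X Y -> link Y Z -> ~~ link X Z.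
Proof.
case: X Y Z => [[[a b] c] d] [[[a' b'] c'] d'] [[[a'' b''] c''] d''].
move=> XY YZ; apply/negP => XZ; case/orP: XY; case/orP: YZ; case/orP: XZ => /=;
  rewrite -?val_eqE /=; lia.
Qed.

Lemma shift_arc_link X Y : shift_arc X Y -> link X Y || link Y X.
Proof. by rewrite /link => /orP[->|->]; rewrite ?orbT. Qed.

Lemma shift_arc_irrefl : irreflexive shift_arc.
Proof.
by move=> X; apply/negP => /shift_arc_link; rewrite orbb => /link_lt; rewrite ltnn.
Qed.

Lemma shift_arc_asym X Y : shift_arc X Y -> ~~ shift_arc Y X.
Proof.
case: X Y => [[[a b] c] d] [[[a' b'] c'] d'] XY; apply/negP => YX.
by case/orP: XY; case/orP: YX => /=; rewrite -?val_eqE /=; lia.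
Qed.

Definition shift_adj : rel quad := fun X Y => shift_arc X Y || shift_arc Y X.

(** Of the eight orientations of a triangle by [link], six are transitive, against
    [link_intransitive], and two are cyclic, against [link_lt]. *)
Lemma shift_adj_triangle_free X Y Z :
  shift_adj X Y -> shift_adj Y Z -> shift_adj X Z -> False.
Proof.
have adjP U V : shift_adj U V -> link U V \/ link V U.
  by case/orP=> /shift_arc_link/orP[]; tauto.
have linkN U V W : link U V -> link V W -> link U W -> False.
  by move=> UV VW; apply/negP; exact: link_intransitive UV VW.
have linkC U V W : link U V -> link V W -> link W U -> False.
  by move=> /link_lt UV /link_lt VW /link_lt; rewrite ltnNge (ltnW (ltn_trans UV VW)).
move=> /adjP[] XY /adjP[] YZ /adjP[] XZ; by [exact: (linkN X Y Z) |
  exact: (linkN X Z Y) | exact: (linkN Y X Z) | exact: (linkN Y Z X) |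
  exact: (linkN Z X Y) | exact: (linkN Z Y X) | exact: (linkC X Y Z) |
  exact: (linkC X Z Y)].
Qed.

Definition shift_digraph : digraph := Digraph shift_arc_irrefl.

Lemma link1_path_closed V U W X :
  link1 V U -> link1 U W -> link1 W X -> link3 V X.
Proof.
case: V U W X => [[[a b] c] d] [[[a' b'] c'] d'] [[[p q] r] s] [[[p' q'] r'] s'].
by rewrite /= -?val_eqE /=; lia.
Qed.

Lemma dicoloring_link1_path k (f : shift_digraph -> 'I_k) V U W X :
  dicoloring f -> link1 V U -> link1 U W -> link1 W X ->
  f V = f X -> f U = f X -> f W = f X -> False.
Proof.
move=> fc VU UW WX fV fU fW; apply: (fc (f X) [:: V; U; W; X]); last first.
  by move=> Y; rewrite !inE => /or4P[]/eqP->.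
have lt1 Y Z : link1 Y Z -> Y.1.1.1 < Z.1.1.1.
  by move=> YZ; apply: link_lt; rewrite /link YZ.
apply/and3P; split=> //.
  have neq (Y Z : quad) : Y.1.1.1 < Z.1.1.1 -> (Y == Z) = false.
    by move=> YZ; apply/eqP => E; rewrite E ltnn in YZ.
  have := lt1 _ _ VU; have := lt1 _ _ UW; have := lt1 _ _ WX => wx uw vu.
  have ux := ltn_trans uw wx; have vw := ltn_trans vu uw.
  by rewrite /= !inE !neq // (ltn_trans vw wx).
by rewrite /= /shift_arc VU UW WX (link1_path_closed VU UW WX) !orbT.
Qed.

(* The two booleans record whether a monochromatic link1-path with two,
   respectively three, vertices ends at the given quadruple. *)
Lemma dicoloring_proper_link1 k (f : shift_digraph -> 'I_k) :
  dicoloring f ->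
  exists g : quad -> 'I_k * bool * bool, forall X Y, link1 X Y -> g X <> g Y.
Proof.
move=> fc.
pose P1 X := [exists W, link1 W X && (f W == f X)].
pose P2 X := [exists W, [&& link1 W X, f W == f X & P1 W]].
exists (fun X => (f X, P1 X, P2 X)) => W X WX [fWX P1WX P2WX].
have P1X : P1 X by apply/existsP; exists W; rewrite WX fWX eqxx.
have P2X : P2 X by apply/existsP; exists W; rewrite WX fWX eqxx P1WX.
(* Since [P2] also holds at W, the path ending there extends through X to four vertices of one
   color. *)
move: P2X; rewrite -P2WX => /existsP[U /and3P[UW /eqP fU]].
case/existsP=> V /andP[VU /eqP fV].
by apply: (dicoloring_link1_path fc VU UW WX); rewrite ?fV ?fU.
Qed.

(** If (a,b,c) and (b,c,d) had the same set, the color of (a,b,c,d) would recur at some (b,c,d,e),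
    to which it is 1-linked. The same argument works one level down for pairs and then for
    points. *)
Lemma link1_coloring_card (C : finType) (g : quad -> C) :
  (forall X Y, link1 X Y -> g X <> g Y) -> N <= #|{set {set {set C}}}|.
Proof.
move=> gP.
pose h3 (a b c : 'I_N) : {set C} :=
  [set x | [exists d : 'I_N, (c < d) && (x == g (a, b, c, d))]].
pose h2 (a b : 'I_N) : {set {set C}} :=
  [set x | [exists c : 'I_N, (b < c) && (x == h3 a b c)]].
pose h1 (a : 'I_N) : {set {set {set C}}} :=
  [set x | [exists b : 'I_N, (a < b) && (x == h2 a b)]].
have h3P (a b c d : 'I_N) : a < b -> b < c -> c < d -> h3 a b c <> h3 b c d.
  move=> ab bc cd E.
  have: g (a, b, c, d) \in h3 a b c.
    by rewrite inE; apply/existsP; exists d; rewrite cd /=.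
  rewrite E inE => /existsP[e /andP[de /eqP]]; apply: gP.
  by rewrite /= ab bc cd de !eqxx.
have h2P (a b c : 'I_N) : a < b -> b < c -> h2 a b <> h2 b c.
  move=> ab bc E; have: h3 a b c \in h2 a b.
    by rewrite inE; apply/existsP; exists c; rewrite bc /=.
  by rewrite E inE => /existsP[d /andP[cd /eqP]]; apply: h3P.
have h1P (a b : 'I_N) : a < b -> h1 a <> h1 b.
  move=> ab E; have: h2 a b \in h1 a.
    by rewrite inE; apply/existsP; exists b; rewrite ab /=.
  by rewrite E inE => /existsP[c /andP[bc /eqP]]; apply: h2P.
rewrite -[N in N <= _]card_ord; apply: (leq_card h1) => a b E.
by apply: val_inj; case: (ltngtP a b) => // /h1P; rewrite E.
Qed.

End ShiftDigraph.

Lemma shift_digraph_not_dicolorable k :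
  exists N, ~ dicolorable (shift_digraph N) k.
Proof.
exists #|{set {set {set ('I_k * bool * bool)}}}|.+1 => -[f].
by case/dicoloring_proper_link1=> g /link1_coloring_card; rewrite ltnn.
Qed.

(** * Complete digraphs and tournaments *)

Definition complete (H : digraph) : Prop :=
  forall x y : H, x != y -> arc x y.

Definition tournament (H : digraph) : Prop :=
  forall x y : H, x != y -> arc x y (+) arc y x.

Lemma complete_induced (D H : digraph) :
  complete D -> contains_induced D H -> complete H.
Proof. by move=> Dc [f fi fa] x y xy; rewrite -fa Dc // inj_eq. Qed.

Lemma tournament_induced (D H : digraph) :
  tournament D -> contains_induced D H -> tournament H.
Proof. by move=> Dt [f fi fa] x y xy; rewrite -!fa Dt // inj_eq. Qed.

Lemma two_vertices (H : digraph) :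
  1 < #|H| -> exists x y : H, x != y.
Proof. by case/card_gt1P=> x [y [_ _ xy]]; exists x, y. Qed.

Lemma complete_not_tournament (H : digraph) :
  1 < #|H| -> complete H -> ~ tournament H.
Proof.
case/two_vertices=> x [y xy] Hc /(_ x y xy).
by rewrite !Hc // eq_sym.
Qed.

Lemma triangle_free_induced (D H : digraph) :
  (forall x y z : D, arc x y || arc y x -> arc y z || arc z y ->
    arc x z || arc z x -> False) ->
  (forall x y : H, x != y -> arc x y || arc y x) ->
  contains_induced D H -> forall x y z : H, [|| x == y, y == z | x == z].
Proof.
move=> Dt Hs [f fi fa] x y z; apply/negPn/negP; rewrite !negb_or.
by case/and3P=> /Hs xy /Hs yz /Hs xz; apply: (Dt (f x) (f y) (f z)); rewrite !fa.
Qed.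

Lemma complete_digon (H : digraph) :
  1 < #|H| -> (forall x y z : H, [|| x == y, y == z | x == z]) ->
  complete H -> isomorphic H digon.
Proof.
case/two_vertices=> x [y xy] H2 Hc.
have Hxy z : z = if z == x then x else y.
  by case: eqP => // /eqP zx; have /or3P[] := H2 z x y;
    rewrite ?(negPf zx) ?(negPf xy) // => /eqP.
exists (fun z => z == x).
  exists (fun b : bool => if b then x else y) => [z|[]]; first by rewrite -Hxy.
    exact: eqxx.
  by rewrite eq_sym (negPf xy).
move=> z t; rewrite /= /digon_arc [in RHS](Hxy z) [in RHS](Hxy t).
by case: (z == x); case: (t == x); rewrite ?arc_irrefl ?Hc // eq_sym.
Qed.

Lemma tournament_arrow (H : digraph) :
  1 < #|H| -> (forall x y z : H, [|| x == y, y == z | x == z]) ->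
  tournament H -> isomorphic H arrow.
Proof.
case/two_vertices=> x0 [y0 xy0] H2 Ht.
have [x [y [xy axy ayx]]] : exists x y : H, [/\ x != y, arc x y & ~~ arc y x].
  have := Ht x0 y0 xy0; case: (boolP (arc x0 y0)) => [a1 a2|a1 a2].
    by exists x0, y0.
  by exists y0, x0; rewrite eq_sym; split.
have Hxy z : z = if z == y then y else x.
  by case: eqP => // /eqP zy; have /or3P[] := H2 z y x;
    rewrite ?(negPf zy) 1?[y == x]eq_sym ?(negPf xy) // => /eqP.
exists (fun z => z == y).
  exists (fun b : bool => if b then y else x) => [z|[]]; first by rewrite -Hxy.
    exact: eqxx.
  exact: negPf xy.
move=> z t; rewrite /= /arrow_arc [in RHS](Hxy z) [in RHS](Hxy t).
by case: (z == y); case: (t == y); rewrite ?arc_irrefl ?axy ?(negPf ayx).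
Qed.

(** * Superdigraphs on the same vertex set *)

Section Superdigraphs.

Variable D : digraph.

Definition complete_arc : rel D := fun x y => x != y.

Lemma complete_arc_irrefl : irreflexive complete_arc.
Proof. by move=> x; rewrite /complete_arc eqxx. Qed.

Definition completion : digraph := Digraph complete_arc_irrefl.

(** Only nonadjacent pairs receive a new arc, so a digon would survive; hence the asymmetry assumed
    in [tournament_completion_tournament]. *)
Definition tournament_arc : rel D := fun x y =>
  arc x y || ~~ arc y x && (enum_rank x < enum_rank y).

Lemma tournament_arc_irrefl : irreflexive tournament_arc.
Proof. by move=> x; rewrite /tournament_arc arc_irrefl ltnn andbF. Qed.

Definition tournament_completion : digraph := Digraph tournament_arc_irrefl.

Definition sym_arc : rel D := fun x y => arc x y || arc y x.

Lemma sym_arc_irrefl : irreflexive sym_arc.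
Proof. by move=> x; rewrite /sym_arc arc_irrefl. Qed.

Definition symmetrization : digraph := Digraph sym_arc_irrefl.

Lemma completion_complete : complete completion.
Proof. by []. Qed.

Lemma tournament_completion_tournament :
  (forall x y : D, arc x y -> ~~ arc y x) -> tournament tournament_completion.
Proof.
move=> Das x y xy; rewrite /= /tournament_arc.
case: (boolP (@arc D x y)) => [/Das/negPf->//|_].
case: (boolP (@arc D y x)) => //= _.
case: ltngtP => // /val_inj/enum_rank_inj E; by rewrite E eqxx in xy.
Qed.

End Superdigraphs.

Theorem theorem6 :
  [/\ size_two (pair_set digon arrow),
      nontrivial (pair_set digon arrow),
      heroic (pair_set digon arrow)
    & forall F : digraph -> Prop,
        size_two F -> nontrivial F -> heroic F ->
        same_digraphs F (pair_set digon arrow)].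
Proof.
have iso_refl (D : digraph) : isomorphic D D by exists id => //; exists id.
split.
- exists digon, arrow; split; last by split=> D DF; exists D.
  by case=> f _ /[dup] /(_ true false) + /(_ false true) => /=;
    rewrite /arrow_arc; case: (f true); case: (f false).
- by move=> D [->|->]; rewrite card_bool.
- exists 1 => D DF; apply: dichromatic_min; exists (fun=> ord0) => c p.
  (* Two adjacent vertices induce a digon or an arrow, so the digraphs in question have no arcs and
     one color suffices. *)
  suff noarc (x y : D) : ~~ arc x y.
    by case: p => [|x [|y p]] /and3P[] //= _ _; rewrite (negPf (noarc _ _)).
  apply/negP => xy.
  have xNy : x != y by apply/eqP => E; rewrite E arc_irrefl in xy.
  have fi : injective (fun b : bool => if b then y else x).
    by move=> [] [] // E; move: xNy; rewrite E eqxx.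
  case: (boolP (arc y x)) => yx.
    apply: (DF digon); first by left.
    by exists (fun b : bool => if b then y else x) => // -[] []; rewrite ?arc_irrefl.
  apply: (DF arrow); first by right.
  exists (fun b : bool => if b then y else x) => // -[] [];
    by rewrite ?arc_irrefl //= (negPf yx).
move=> F [A [B [_ [FAB ABF]]]] Fnt [k Fk].
have [N Gk] := shift_digraph_not_dicolorable k; set G := shift_digraph N in Gk.
have cA : 1 < #|A|.
  by have [|D /Fnt + /isomorphic_card <-] := ABF A; first by left.
have cB : 1 < #|B|.
  by have [|D /Fnt + /isomorphic_card <-] := ABF B; first by right.
(* Otherwise [E] would lie in [Forb_ind F] and be dicolorable with [k] colors. *)
have hit (E : digraph) : ~ dicolorable E k ->
    contains_induced E A \/ contains_induced E B.
  move=> Ek; apply: contrapT => /not_orP[EA EB]; apply: Ek.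
  apply: dicolorable_leq (dicolorable_dichromatic E); apply: Fk => H FH EH.
  by have [K [->|->] HK] := FAB H FH; [apply: EA|apply: EB];
    exact: contains_induced_iso HK EH.
have hitS (e : rel G) (ei : irreflexive e) : subrel (@arc G) e ->
    contains_induced (Digraph ei) A \/ contains_induced (Digraph ei) B.
  by move=> Ge; apply: hit => /(dicolorable_super Ge).
have Gasym (x y : G) : arc x y -> ~~ arc y x by exact: shift_arc_asym.
have hitK : contains_induced (completion G) A \/ contains_induced (completion G) B.
  by apply: hitS => x y xy; apply/eqP => E; rewrite E arc_irrefl in xy.
have hitT : contains_induced (tournament_completion G) A \/
    contains_induced (tournament_completion G) B.
  by apply: hitS => x y xy; rewrite /tournament_arc xy.
have hitY : contains_induced (symmetrization G) A \/
    contains_induced (symmetrization G) B.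
  by apply: hitS => x y xy; rewrite /sym_arc xy.
have {hit hitS} hitG := hit G Gk.
have Kc H : contains_induced (completion G) H -> complete H.
  exact: complete_induced (@completion_complete G).
have Tt H : contains_induced (tournament_completion G) H -> tournament H.
  exact: tournament_induced (tournament_completion_tournament Gasym).
(* All arcs of the symmetrization lie in digons, so it cannot contain the tournament [Q] and
   contains [P]; [G] has no digon, so it contains [Q]. *)
have solve (P Q : digraph) : 1 < #|P| -> 1 < #|Q| -> complete P -> tournament Q ->
    contains_induced (symmetrization G) P \/ contains_induced (symmetrization G) Q ->
    contains_induced G P \/ contains_induced G Q ->
    isomorphic P digon /\ isomorphic Q arrow.
  move=> cP cQ Pc Qt hY hG; split.
  - case: hY => [hP|[f fi fa]]; last first.
      have [x [y xy]] := two_vertices cQ.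
      by have := Qt x y xy; rewrite -!fa /= /sym_arc orbC addbb.
    apply: (complete_digon cP _ Pc); apply: triangle_free_induced hP => [x y z|x y xy].
      have symE (u v : G) : sym_arc u v || sym_arc v u = shift_adj u v.
        by rewrite /sym_arc [arc v u || _]orbC orbb.
      by rewrite /= !symE; exact: shift_adj_triangle_free.
    by rewrite Pc.
  - case: hG => [[f fi fa]|hQ].
      have [x [y xy]] := two_vertices cP.
      have := Gasym (f x) (f y); rewrite !fa !Pc // 1?eq_sym //.
      by move=> /(_ isT).
    apply: (tournament_arrow cQ _ Qt); apply: triangle_free_induced hQ => [x y z|x y xy].
      exact: shift_adj_triangle_free.
    by have := Qt x y xy; case: (arc x y).
have fin P Q : isomorphic P digon -> isomorphic Q arrow ->
    (forall D, pair_set A B D <-> pair_set P Q D) ->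
    same_digraphs F (pair_set digon arrow).
  move=> Pd Qa AB; split=> [D /FAB[E /AB[]-> DE]|E [->|->]].
  - by exists digon; [left|exact: isomorphic_trans DE Pd].
  - by exists arrow; [right|exact: isomorphic_trans DE Qa].
  - have [|D FD DP] := ABF P; first by apply/AB; left.
    by exists D => //; exact: isomorphic_trans DP Pd.
  - have [|D FD DQ] := ABF Q; first by apply/AB; right.
    by exists D => //; exact: isomorphic_trans DQ Qa.
(* The completion makes one of [A], [B] complete; this one is not a tournament, so the tournament
   completion contains the other. *)
have [Ac|Bc] : complete A \/ complete B by case: hitK => /Kc; tauto.
- have Bt : tournament B.
    by case: hitT => /Tt // At; case: (complete_not_tournament cA Ac).
  by have [Ad Ba] := solve A B cA cB Ac Bt hitY hitG; exact: fin Ad Ba _.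
- have At : tournament A.
    by case: hitT => /Tt // Bt; case: (complete_not_tournament cB Bc).
  have [||Bd Aa] := solve B A cB cA Bc At; [tauto|tauto|].
  by apply: fin Bd Aa _ => D; rewrite /pair_set; tauto.
Qed.
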